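(* Let $K$ be a field, $n \ge 1$, $S = K[x_1,\dots,x_n]$, let $I \subset S$ be a squarefree monomial ideal, and let $I^c \subset S$ be the $K$-linear subspace spanned by all monomials of $S$ not belonging to $I$. Then Janet's algorithm gives recursively a squarefree Stanley decomposition of $I^c$; that is, the finite collection $\mathcal{E}_n(I)$ of Stanley spaces produced by Janet's algorithm for $I^c$ (as described in the context) satisfies $$I^c = \bigoplus_{uK[Z] \in \mathcal{E}_n(I)} uK[Z]$$ as $K$-vector spaces, and every $uK[Z] \in \mathcal{E}_n(I)$ is a squarefree Stanley space.
   Context: Stanley spaces. For a monomial $u \in S$ and a subset $Z \subseteq \{x_1,\dots,x_n\}$, $uK[Z]$ denotes the $K$-subspace of $S$ whose basis consists of all monomials $uv$ with $v$ a monomial in $K[Z]$; it is called a Stanley space of dimension $|Z|$. It is a squarefree Stanley space if $u$ is a squarefree monomial and $\operatorname{supp}(u) \subseteq Z$, where $\operatorname{supp}(u)$ is the set of variables dividing $u$. A (squarefree) Stanley decomposition of a $K$-subspace $V \subseteq S$ spanned by monomials is a presentation of $V$ as a finite direct sum of (squarefree) Stanley spaces (the empty sum being allowed when $V = 0$). As $S = I^c \oplus I$, the residue classes of the monomials in $I^c$ form a $K$-basis of $S/I$, and a Stanley decomposition of $I^c$ is also called a Stanley decomposition of $S/I$. Janet's algorithm for $I^c$. The order of the variables is fixed. The algorithm assigns to each squarefree monomial ideal $I \subset K[x_1,\dots,x_n]$ a finite collection $\mathcal{E}_n(I)$ of Stanley spaces, recursively on $n$. For $n = 1$: $\mathcal{E}_1(0)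 = \{K[x_1]\}$, $\mathcal{E}_1((x_1)) = \{K\}$ (that is, $u=1$, $Z=\emptyset$), and $\mathcal{E}_1(K[x_1]) = \emptyset$. For $n \ge 2$: put $S' = K[x_1,\dots,x_{n-1}]$ and for $k = 0,1$ let $I_k \subset S'$ be the squarefree monomial ideal defined by $I \cap x_n^k S' = x_n^k I_k$, i.e. the monomials of $I_k$ are the monomials $u \in S'$ with $u x_n^k \in I$; one has $I_0 \subseteq I_1$. With the recursively computed collections $\mathcal{E}_{n-1}(I_0)$ and $\mathcal{E}_{n-1}(I_1)$, define: (C1) if $I_0 \ne 0$ and $I_0 \neq I_1$: $$\mathcal{E}_n(I) = \mathcal{E}_{n-1}(I_0) \cup \{\, u x_n K[Z \cup \{x_n\}] : uK[Z] \in \mathcal{E}_{n-1}(I_1) \,\};$$ (C2) if $I_0 = I_1$: $$\mathcal{E}_n(I) = \{\, u K[Z \cup \{x_n\}] : uK[Z] \in \mathcal{E}_{n-1}(I_0) \,\};$$ (C3) if $I_0 = 0$ and $I_1 \neq 0$: $$\mathcal{E}_n(I) = \{ K[x_1,\dots,x_{n-1}] \} \cup \{\, u x_n K[Z \cup \{x_n\}] : uK[Z] \in \mathcal{E}_{n-1}(I_1) \,\}.$$ *)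

(* Defs.v *)
From HB Require Import structures.
From mathcomp Require Import all_boot all_order all_algebra.
From mathcomp Require Import finmap mpoly.
From mathcomp Require Import boolp classical_sets.

Set Implicit Arguments.
Unset Strict Implicit.
Unset Printing Implicit Defensive.

Import GRing.Theory.

Local Open Scope ring_scope.
Local Open Scope fset_scope.
Local Open Scope classical_set_scope.

(* Throughout, a monomial of K[x_1, ..., x_n] is its exponent vector
   m : 'X_{1..n}, the variable x_(i+1) is 'X_i for i : 'I_n, and a set of
   variables is a set of indices Z : {set 'I_n}. *)

Section Ideals.
Variable R : comNzRingType.

Definition ideal_gen (A : set R) : set R :=
  [set p | exists2 s : seq (R * R),
     (forall c, c \in s -> A c.2) & p = \sum_(c <- s) c.1 * c.2].

End Ideals.

Section Monomials.
Variable n : nat.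

Definition squarefree (m : 'X_{1..n}) : Prop := forall i : 'I_n, (m i <= 1)%N.

Definition msupport (m : 'X_{1..n}) : {set 'I_n} :=
  [set i | m i != 0%N]%SET.

End Monomials.

Definition squarefree_monomial_ideal (K : fieldType) (n : nat)
    (I : set {mpoly K[n]}) : Prop :=
  exists2 G : set 'X_{1..n}, (forall m, G m -> squarefree m)
    & I = ideal_gen [set ('X_[m] : {mpoly K[n]}) | m in G].

Definition monomial_span (K : fieldType) (n : nat) (M : set 'X_{1..n}) :
    set {mpoly K[n]} :=
  [set p | exists (s : seq 'X_{1..n}) (c : 'X_{1..n} -> K),
     (forall m, m \in s -> M m) /\ p = \sum_(m <- s) c m *: 'X_[m]].
Arguments monomial_span K {n} M.

Definition ideal_compl (K : fieldType) (n : nat) (I : set {mpoly K[n]}) :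
    set {mpoly K[n]} :=
  monomial_span K [set m | ~ I 'X_[m]].

(* The pair (u, Z) stands for the Stanley space u K[Z]; it is determined by
   that space, so a collection of Stanley spaces is a collection of pairs. *)
Notation stanley n := ('X_{1..n} * {set 'I_n})%type.

Definition stanley_space (K : fieldType) (n : nat) (s : stanley n) :
    set {mpoly K[n]} :=
  monomial_span K
    [set (s.1 + v)%MM | v in [set v | msupport v \subset s.2]].

Definition squarefree_stanley (n : nat) (s : stanley n) : Prop :=
  squarefree s.1 /\ msupport s.1 \subset s.2.

(* V is the internal direct sum of the subspaces W i, i in E: the sums of
   families (f i in W i) are exactly the elements of V, and each element of V
   is such a sum in only one way. *)
Definition direct_sum (V : zmodType) (T : choiceType) (E : {fset T})
    (W : T -> set V) (U : set V) : Prop :=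
  U = [set \sum_(i <- E) f i | f in [set f | forall i, i \in E -> W i (f i)]]
  /\ forall f g : T -> V,
       (forall i, i \in E -> W i (f i)) ->
       (forall i, i \in E -> W i (g i)) ->
       \sum_(i <- E) f i = \sum_(i <- E) g i ->
       forall i, i \in E -> f i = g i.

Definition stanley_decomposition (K : fieldType) (n : nat)
    (V : set {mpoly K[n]}) (E : {fset stanley n}) : Prop :=
  direct_sum E (@stanley_space K n) V.

Definition squarefree_stanley_decomposition (K : fieldType) (n : nat)
    (V : set {mpoly K[n]}) (E : {fset stanley n}) : Prop :=
  stanley_decomposition V E /\ forall s, s \in E -> squarefree_stanley s.

Section Janet.
Variable K : fieldType.

(* This I_k is the only subset of S' = K[x_1, ..., x_n] such that the
   intersection of I with x_(n+1)^k S' is x_(n+1)^k I_k. *)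
Definition janet_slice (n k : nat) (I : set {mpoly K[n.+1]}) :
    set {mpoly K[n]} :=
  [set p | I (mwiden p * 'X_ord_max ^+ k)].

Section Lifts.
Variable n : nat.

Definition widen_vars (Z : {set 'I_n}) : {set 'I_n.+1} :=
  [set widen_ord (leqnSn n) i | i in Z]%SET.

(* u K[Z], u K[Z, x_(n+1)] and u x_(n+1) K[Z, x_(n+1)]. *)
Definition stanley_widen (s : stanley n) : stanley n.+1 :=
  (mnmwiden s.1, widen_vars s.2).

Definition stanley_addvar (s : stanley n) : stanley n.+1 :=
  (mnmwiden s.1, ord_max |: widen_vars s.2)%SET.

Definition stanley_mulvar (s : stanley n) : stanley n.+1 :=
  ((mnmwiden s.1 + U_(ord_max))%MM, ord_max |: widen_vars s.2)%SET.

End Lifts.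

(* janet n is E_(n+1), on the ideals of K[x_1, ..., x_(n+1)]. The values for
   arguments that are not squarefree monomial ideals are irrelevant; for
   n = 0 such an ideal is 0, (x_1) or K[x_1], the last being the final case. *)
Fixpoint janet (n : nat) : set {mpoly K[n.+1]} -> {fset stanley n.+1} :=
  match n return set {mpoly K[n.+1]} -> {fset stanley n.+1} with
  | 0 => fun I =>
      if `[< I = [set 0] >] then [fset (0%MM, [set: 'I_1]%SET)]
      else if `[< I = ideal_gen [set 'X_ord0] >] then [fset (0%MM, finset.set0)]
      else fset0
  | n'.+1 => fun I =>
      let I0 := janet_slice 0 I in
      let I1 := janet_slice 1 I in
      if `[< I0 = I1 >] then                                     (* (C2) *)
        [fset stanley_addvar s | s in janet I0]
      else if `[< I0 = [set 0] >] then                           (* (C3) *)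
        ([fset stanley_widen (0%MM, [set: 'I_n'.+1]%SET)]
          `|` [fset stanley_mulvar s | s in janet I1])%fset
      else                                                       (* (C1) *)
        ([fset stanley_widen s | s in janet I0]
          `|` [fset stanley_mulvar s | s in janet I1])%fset
  end.

End Janet.

(* Main.v *)
Require Import Defs.
From HB Require Import structures.
From mathcomp Require Import all_boot all_order all_algebra.
From mathcomp Require Import finmap mpoly.
From mathcomp Require Import boolp classical_sets.

(* A Stanley space is spanned by monomials, so a decomposition of I^c is the
   same thing as a partition of the set of monomials outside I. A squarefree
   monomial ideal corresponds to an up-closed set of exponent vectors that is
   stable under capping all exponents at 1. Hence for k >= 1 the monomial
   u x_n^k lies in I iff u lies in I_1, and for k = 0 iff u lies in I_0; lifting
   the partitions for I_0 and I_1 gives the one for I. *)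

Set Implicit Arguments.
Unset Strict Implicit.
Unset Printing Implicit Defensive.

Import GRing.Theory.

Local Open Scope ring_scope.
Local Open Scope fset_scope.
Local Open Scope classical_set_scope.

Lemma bigsum_neq0 (V : nmodType) (T : eqType) (s : seq T) (F : T -> V) :
  \sum_(x <- s) F x != 0 -> exists2 x, x \in s & F x != 0.
Proof.
move=> nz; apply: contrapT => no; move/eqP: nz; apply.
rewrite big_seq big1 // => x xs; apply/eqP/negPn/negP => Fx.
by apply: no; exists x.
Qed.

(** The old indices appear through [widen_ord], as in [widen_vars], rather than through
    [lift ord_max], so that pointwise claims about lifts split directly. *)
Lemma ord_max_ind (n : nat) (P : 'I_n.+1 -> Prop) :
  (forall i : 'I_n, P (widen_ord (leqnSn n) i)) -> P ord_max -> forall i, P i.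
Proof.
move=> Pw Pm i; case: (unliftP ord_max i) => [j|] -> //.
suff -> : lift ord_max j = widen_ord (leqnSn n) j by [].
exact/val_inj/lift_max.
Qed.

(** * Stanley decompositions as partitions of sets of monomials *)

Section MonomialSpans.
Variables (K : fieldType) (n : nat).
Implicit Types (M : set 'X_{1..n}) (p : {mpoly K[n]}) (s : stanley n).

(** Every polynomial is the combination of its own monomials, so membership in the span is a
    condition on the support. *)
Lemma monomial_spanP M p :
  monomial_span K M p <-> forall m, p@_m != 0 -> M m.
Proof.
split=> [[s [c [sM ->]]] m|pM].
  rewrite raddf_sum /= => /bigsum_neq0[k ks].
  rewrite mcoeffZ mcoeffX; case: (eqVneq k m) => [<- _|_]; first exact: sM.
  by rewrite mulr0 eqxx.
exists (msupp p), (fun m => p@_m); split; last exact: mpolyE.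
by move=> m; rewrite mcoeff_msupp; apply: pM.
Qed.

(** Boolean test for a monomial of $uK[Z]$ that mentions no cofactor: $u$ divides it, with equal
    exponents outside $Z$. Being boolean, it can filter sums. *)
Definition stanley_mon s : pred 'X_{1..n} := fun m =>
  [forall i, (s.1 i <= m i)%N && ((i \in s.2) || (m i == s.1 i))].

Lemma stanley_monP s m :
  (exists2 v, msupport v \subset s.2 & (s.1 + v)%MM = m) <-> stanley_mon s m.
Proof.
split=> [[v vs <-]|/forallP sm].
  apply/forallP => i; rewrite mnmDE leq_addr /=.
  case: (boolP (i \in s.2)) => //= iNs.
  have: i \notin msupport v by apply: contra iNs; apply: (fintype.subsetP vs).
  by rewrite inE negbK => /eqP->; rewrite addn0.
exists (m - s.1)%MM; last first.
  apply/mnmP => i; rewrite mnmDE mnmBE subnKC //.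
  by case/andP: (sm i).
apply/fintype.subsetP => i; rewrite inE mnmBE.
case/andP: (sm i) => _ /orP[//|/eqP->]; by rewrite subnn.
Qed.

Lemma stanley_spaceP s p :
  stanley_space s p <-> forall m, p@_m != 0 -> stanley_mon s m.
Proof.
rewrite /stanley_space; split.
  by move/monomial_spanP => h m /h; move/stanley_monP.
move=> h; apply/monomial_spanP => m /h; move/stanley_monP => [v vs <-].
by exists v.
Qed.

Definition monomial_partition (E : {fset stanley n}) M : Prop :=
  (forall m, M m <-> exists2 s, s \in E & stanley_mon s m) /\
  (forall m s t, s \in E -> t \in E ->
     stanley_mon s m -> stanley_mon t m -> s = t).

(** The blocks are disjoint, so no other summand contributes at [m]. Reading a component off the sum
    in this way serves both existence and uniqueness. *)
Lemma mcoeff_stanley_sum (E : {fset stanley n}) M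
    (f : stanley n -> {mpoly K[n]}) :
  monomial_partition E M ->
  (forall s, s \in E -> stanley_space s (f s)) ->
  forall s m, s \in E -> stanley_mon s m ->
  (\sum_(t <- E) f t)@_m = (f s)@_m.
Proof.
move=> [_ disj] fE s m sE sm.
rewrite (bigD1_seq s) ?fset_uniq //= raddfD raddf_sum /= big_seq_cond big1 ?addr0 //.
move=> t /andP[tE /eqP ts]; apply/eqP/negPn/negP => ftm.
by apply: ts; apply: (disj m) => //; apply: (stanley_spaceP _ _).1 ftm; apply: fE.
Qed.

Lemma partition_decomposition (E : {fset stanley n}) M :
  monomial_partition E M -> stanley_decomposition (monomial_span K M) E.
Proof.
move=> EM; have [cov disj] := EM; split.
  apply/seteqP; split=> [p /monomial_spanP pM|_ [f fE <-]].
    (* The component at [s] is the part of [p] supported on the block of [s]. *)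
    pose f s := \sum_(m <- msupp p | stanley_mon s m) p@_m *: 'X_[m].
    have fsE s m : (f s)@_m = if stanley_mon s m then p@_m else 0.
      rewrite /f {1}big_mkcond /= raddf_sum /=.
      (* Only the term with [k = m] has a coefficient at [m], so the filter may be tested at [m]
         instead of [k]. *)
      transitivity (\sum_(k <- msupp p)
        (if stanley_mon s m then p@_k *: 'X_[k] else 0 : {mpoly K[n]})@_m).
        apply: eq_bigr => k _; case: (eqVneq k m) => [->//|km].
        by do 2!case: ifP => _; rewrite ?mcoeff0 ?mcoeffZ ?mcoeffX ?(negPf km) ?mulr0.
      rewrite -raddf_sum /=; case: ifP => _; first by rewrite -mpolyE.
      by rewrite big1 ?mcoeff0.
    have fE s : s \in E -> stanley_space s (f s).
      move=> _; apply/stanley_spaceP => m; rewrite fsE.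
      by case: ifP => //; rewrite eqxx.
    exists f => //; apply/mpolyP => m.
    have [pm0|pm] := eqVneq p@_m 0; last first.
      have [s sE sm] := (cov m).1 (pM m pm).
      by rewrite (mcoeff_stanley_sum EM fE sE sm) fsE sm.
    by rewrite raddf_sum /= big1 // => s _; rewrite fsE pm0 if_same.
  apply/monomial_spanP => m; rewrite raddf_sum /= => /bigsum_neq0[s sE fsm].
  by apply/cov; exists s => //; apply: (stanley_spaceP _ _).1 fsm; apply: fE.
move=> f g fE gE fg s sE; apply/mpolyP => m.
case: (boolP (stanley_mon s m)) => sm.
  by rewrite -(mcoeff_stanley_sum EM fE sE sm) fg (mcoeff_stanley_sum EM gE sE sm).
(* Outside the block of [s], both components have coefficient zero. *)
have coef0 (h : stanley n -> {mpoly K[n]}) :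
    stanley_space s (h s) -> (h s)@_m = 0.
  by move/stanley_spaceP/(_ m) => hs; apply/eqP/negPn/(contra hs).
by rewrite !coef0; auto.
Qed.

End MonomialSpans.

(** * Squarefree monomial ideals through their exponent vectors *)

Section SquarefreeMonomialIdeals.
Variables (K : fieldType) (n : nat).
Implicit Types (I : set {mpoly K[n]}) (p : {mpoly K[n]}).

Lemma mcoeffMX_neq0 p k m :
  (p * 'X_[k])@_m != 0 -> exists2 l, p@_l != 0 & m = (k + l)%MM.
Proof.
rewrite -mcoeff_msupp (perm_mem (msuppMX p k)) => /mapP[l lp ->].
by exists l => //; rewrite -mcoeff_msupp.
Qed.

(** Each term of a multiple of $X^g$ is divisible by $X^g$; conversely, every term of [p] is written
    as a multiple of one chosen generator. *)
Lemma ideal_gen_monomialsP (G : set 'X_{1..n}) p :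
  ideal_gen [set ('X_[m] : {mpoly K[n]}) | m in G] p <->
  forall m, p@_m != 0 -> exists2 g, G g & (g <= m)%MM.
Proof.
split=> [[s sG ->] m|pG].
  rewrite raddf_sum /= => /bigsum_neq0[c cs].
  have [g Gg <-] := sG c cs.
  by case/mcoeffMX_neq0 => l _ ->; exists g; rewrite ?lem_addr.
(* [h] selects a generator below each exponent in the support; elsewhere [0%MM] is a dummy value. *)
have /choice[h hP] m : exists g, p@_m != 0 -> G g /\ (g <= m)%MM.
  by have [_|/pG[g Gg gm]] := eqVneq p@_m 0; [exists 0%MM | exists g].
exists [seq (p@_m *: 'X_[(m - h m)%MM], 'X_[h m]) | m <- msupp p].
  move=> c /mapP[m]; rewrite mcoeff_msupp => /hP[Ghm _] -> /=.
  by exists (h m).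
rewrite [LHS]mpolyE [RHS]big_map; apply: eq_big_seq => m /=.
rewrite mcoeff_msupp => /hP[_ hm].
by rewrite -scalerAl -mpolyXD submK.
Qed.

(** Exponent vector of the product of the variables dividing the monomial. *)
Definition mrad (m : 'X_{1..n}) : 'X_{1..n} :=
  [multinom minn (m i) 1 | i < n].

Lemma mradE m i : mrad m i = minn (m i) 1.
Proof. exact: mnmE. Qed.

(** A description free of generators, hence easy to pass to slices; the third clause makes [I] the
    span of its monomials. *)
Definition squarefree_monomial_closed I : Prop :=
  [/\ forall m m', (m <= m')%MM -> I 'X_[m] -> I 'X_[m'],
      forall m, I 'X_[m] -> I 'X_[mrad m]
    & forall p, I p <-> forall m, p@_m != 0 -> I 'X_[m]].

Lemma mcoeffX_neq0 (m k : 'X_{1..n}) : ('X_[m] : {mpoly K[n]})@_k != 0 -> k = m.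
Proof. by rewrite mcoeffX; case: (eqVneq m k) => //; rewrite eqxx. Qed.

(** A squarefree generator dividing $X^m$ already divides its capped version, which gives stability
    under [mrad]. *)
Lemma squarefree_monomial_idealP I :
  squarefree_monomial_ideal I <-> squarefree_monomial_closed I.
Proof.
split=> [[G Gsf ->]|[up rad IP]].
  set J := ideal_gen _.
  have JX m : J 'X_[m] <-> exists2 g, G g & (g <= m)%MM.
    split=> [/ideal_gen_monomialsP|Gm]; last first.
      by apply/ideal_gen_monomialsP => k /mcoeffX_neq0->.
    by apply; rewrite mcoeffX eqxx oner_eq0.
  split=> [m m' mm' /JX[g Gg gm]|m /JX[g Gg gm]|p].
  - by apply/JX; exists g => //; apply: lepm_trans mm'.
  - apply/JX; exists g => //; apply/mnm_lepP => i.
    by rewrite mradE leq_min (mnm_lepP gm) Gsf.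
  - split=> [/ideal_gen_monomialsP pJ m /pJ|pJ]; first by move/JX.
    by apply/ideal_gen_monomialsP => m /pJ/JX.
(* All squarefree monomials of [I] serve as generators: any [m] in [I] lies above [mrad m], which is
   one of them. *)
exists [set m | squarefree m /\ I 'X_[m]]; first by move=> m [].
apply/seteqP; split=> p.
  move=> /IP pI; apply/ideal_gen_monomialsP => m /pI Im.
  exists (mrad m); last by apply/mnm_lepP => i; rewrite mradE geq_minl.
  by split; [move=> i; rewrite mradE geq_minr | apply: rad].
move/ideal_gen_monomialsP => pG; apply/IP => m /pG[g [_ Ig] gm].
exact: up gm Ig.
Qed.

End SquarefreeMonomialIdeals.

(** * Exponent vectors, Stanley spaces and slices with one more variable *)

Section LastVariable.
Variables (K : fieldType) (n : nat).
Implicit Types (m : 'X_{1..n}) (s : stanley n) (Z : {set 'I_n}).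

Local Notation widen := (widen_ord (leqnSn n)).

(** The exponent vector of $u x_{n+1}^k$. In this form the monomial of [stanley_mulvar] is the case
    [k = 1] by computation. *)
Definition mrcons m (k : nat) : 'X_{1..n.+1} :=
  (mnmwiden m + U_(ord_max) *+ k)%MM.

Lemma mrcons_widen m k i : mrcons m k (widen i) = m i.
Proof.
rewrite /mrcons mnmDE mnmwiden_widen mulmnE mnm1E.
by rewrite -val_eqE /= gtn_eqF ?mul0n ?addn0.
Qed.

Lemma mrcons_max m k : mrcons m k ord_max = k.
Proof. by rewrite /mrcons mnmDE mnmwiden_ordmax mulmnE mnm1E eqxx mul1n. Qed.

Lemma mrconsP (l : 'X_{1..n.+1}) : exists m k, l = mrcons m k.
Proof.
exists [multinom l (widen i) | i < n], (l ord_max).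
by apply/mnmP; apply: ord_max_ind => [i|]; rewrite ?mrcons_widen ?mrcons_max ?mnmE.
Qed.

Lemma mem_widen_vars Z i : (widen i \in widen_vars Z) = (i \in Z).
Proof. by apply: mem_imset => j k /(congr1 val)/= /val_inj. Qed.

Lemma ord_max_widen_vars Z : (ord_max \in widen_vars Z) = false.
Proof.
by apply/finset.imsetP => -[i _ /(congr1 val)/= E]; have := ltn_ord i; rewrite -E ltnn.
Qed.

Lemma mem_add_widen_vars Z i : (widen i \in ord_max |: widen_vars Z)%SET = (i \in Z).
Proof. by rewrite in_setU1 mem_widen_vars -val_eqE /= ltn_eqF. Qed.

(** The test is coordinatewise, so the last coordinate splits off. The three lifts then differ only
    in the last exponents they allow: zero, any, or positive. *)
Lemma stanley_mon_rcons (t : stanley n.+1) s m k :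
  (forall i, t.1 (widen i) = s.1 i) ->
  (forall i, (widen i \in t.2) = (i \in s.2)) ->
  stanley_mon t (mrcons m k) = stanley_mon s m &&
    ((t.1 ord_max <= k)%N && ((ord_max \in t.2) || (k == t.1 ord_max))).
Proof.
move=> t1 t2; apply/forallP/andP => [tm|[/forallP sm kt]].
  split; last by have := tm ord_max; rewrite mrcons_max.
  by apply/forallP => i; have := tm (widen i); rewrite t1 t2 mrcons_widen.
by apply: ord_max_ind => [i|]; rewrite ?t1 ?t2 ?mrcons_widen ?mrcons_max.
Qed.

Lemma mulvar_widen s i : (stanley_mulvar s).1 (widen i) = s.1 i.
Proof. exact: (mrcons_widen s.1 1). Qed.

Lemma mulvar_max s : (stanley_mulvar s).1 ord_max = 1%N.
Proof. exact: (mrcons_max s.1 1). Qed.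

Lemma stanley_mon_widen s m k :
  stanley_mon (stanley_widen s) (mrcons m k) = stanley_mon s m && (k == 0%N).
Proof.
rewrite (@stanley_mon_rcons _ s) /= => [|i|i]; last 2 first.
- exact: mnmwiden_widen.
- exact: mem_widen_vars.
by rewrite mnmwiden_ordmax ord_max_widen_vars.
Qed.

Lemma stanley_mon_addvar s m k :
  stanley_mon (stanley_addvar s) (mrcons m k) = stanley_mon s m.
Proof.
rewrite (@stanley_mon_rcons _ s) /= => [|i|i]; last 2 first.
- exact: mnmwiden_widen.
- exact: mem_add_widen_vars.
by rewrite mnmwiden_ordmax finset.setU11 andbT.
Qed.

Lemma stanley_mon_mulvar s m k :
  stanley_mon (stanley_mulvar s) (mrcons m k) = stanley_mon s m && (0 < k)%N.
Proof.
rewrite (@stanley_mon_rcons _ s) => [|i|i]; last 2 first.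
- exact: mulvar_widen.
- exact: mem_add_widen_vars.
by rewrite mulvar_max finset.setU11 andbT.
Qed.

Lemma squarefree_stanleyP (l : nat) (t : stanley l) :
  squarefree_stanley t <->
  forall i, (t.1 i <= 1)%N /\ (t.1 i != 0%N -> i \in t.2).
Proof.
split=> [[sf /fintype.subsetP sup] i|h].
  by split=> [|ti]; [exact: sf | apply: sup; rewrite inE].
split=> [i|]; first by case: (h i).
by apply/fintype.subsetP => i; rewrite inE; case: (h i).
Qed.

Lemma squarefree_stanley_widen s :
  squarefree_stanley s -> squarefree_stanley (stanley_widen s).
Proof.
move=> /squarefree_stanleyP sf; apply/squarefree_stanleyP.
apply: ord_max_ind => [i|] /=; last by rewrite mnmwiden_ordmax.
by rewrite mnmwiden_widen mem_widen_vars.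
Qed.

Lemma squarefree_stanley_addvar s :
  squarefree_stanley s -> squarefree_stanley (stanley_addvar s).
Proof.
move=> /squarefree_stanleyP sf; apply/squarefree_stanleyP.
apply: ord_max_ind => [i|] /=; last by rewrite mnmwiden_ordmax.
by rewrite mnmwiden_widen mem_add_widen_vars.
Qed.

Lemma squarefree_stanley_mulvar s :
  squarefree_stanley s -> squarefree_stanley (stanley_mulvar s).
Proof.
move=> /squarefree_stanleyP sf; apply/squarefree_stanleyP.
apply: ord_max_ind => [i|]; last by rewrite mulvar_max finset.setU11.
by rewrite mulvar_widen mem_add_widen_vars.
Qed.

Lemma mcoeff_mwiden_neq0 (p : {mpoly K[n]}) l :
  (mwiden p)@_l != 0 -> exists2 m, p@_m != 0 & l = mnmwiden m.
Proof.
rewrite {1}(mpolyE p) (raddf_sum (@mwiden n K)) raddf_sum /= => /bigsum_neq0[m].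
rewrite mcoeff_msupp mwidenZ mwidenX mcoeffZ mcoeffX => pm.
by case: (eqVneq (mnmwiden m) l) => [<- _|_]; [exists m | rewrite mulr0 eqxx].
Qed.

Lemma mpolyX_rcons m k :
  mwiden 'X_[m] * 'X_ord_max ^+ k = 'X_[mrcons m k] :> {mpoly K[n.+1]}.
Proof. by rewrite mwidenX mpolyXn -mpolyXD. Qed.

(** Multiplication by $x_{n+1}^k$ respects divisibility, so the closure properties descend and the
    induction hypothesis applies to both slices. *)
Lemma janet_slice_closed k (I : set {mpoly K[n.+1]}) :
  squarefree_monomial_closed I -> squarefree_monomial_closed (janet_slice k I).
Proof.
move=> [up rad IP]; split=> [m m' mm'|m|p]; rewrite /janet_slice /=.
- rewrite !mpolyX_rcons; apply: up; apply/mnm_lepP.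
  by apply: ord_max_ind => [i|]; rewrite ?mrcons_max ?mrcons_widen ?(mnm_lepP mm').
(* Capping the whole vector may also lower the last exponent [k]; up-closure restores it. *)
- rewrite !mpolyX_rcons => /rad; apply: up; apply/mnm_lepP.
  by apply: ord_max_ind => [i|]; rewrite mradE ?mrcons_max ?mrcons_widen ?mradE ?geq_minl.
split=> [/IP pI m pm|pI].
  rewrite mpolyX_rcons; apply: pI; rewrite mpolyXn /mrcons addmC mcoeffMX mwiden_mnmwiden //.
apply/IP => l; rewrite mpolyXn => /mcoeffMX_neq0[_ /mcoeff_mwiden_neq0[m pm ->] ->].
by rewrite addmC; have := pI m pm; rewrite /= mpolyX_rcons.
Qed.

Lemma ideal_slice0 (I : set {mpoly K[n.+1]}) m :
  I 'X_[mrcons m 0] <-> janet_slice 0 I 'X_[m].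
Proof. by rewrite /janet_slice /= mpolyX_rcons. Qed.

(** Squarefreeness enters here: capping reduces $x_{n+1}^{k+1}$ to $x_{n+1}$, so all positive
    exponents give the same slice. *)
Lemma ideal_sliceS (I : set {mpoly K[n.+1]}) m k :
  squarefree_monomial_closed I ->
  I 'X_[mrcons m k.+1] <-> janet_slice 1 I 'X_[m].
Proof.
move=> [up rad _]; rewrite /janet_slice /= mpolyX_rcons.
split=> [/rad|]; apply: up; apply/mnm_lepP.
  by apply: ord_max_ind => [i|]; rewrite mradE ?mrcons_max ?mrcons_widen ?geq_minl ?geq_minr.
by apply: ord_max_ind => [i|]; rewrite ?mrcons_max ?mrcons_widen.
Qed.

(** * Lifting partitions along the last variable *)

Section LiftPartitions.
Variable I : set {mpoly K[n.+1]}.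
Hypothesis Icl : squarefree_monomial_closed I.

Local Notation nonmembers J := [set m | ~ J 'X_[m]].

(** Case (C2): with equal slices, the last exponent affects neither membership in [I] nor membership
    in a lifted block. *)
Lemma addvar_partition (E : {fset stanley n}) :
  janet_slice 0 I = janet_slice 1 I ->
  monomial_partition E (nonmembers (janet_slice 0 I)) ->
  monomial_partition [fset stanley_addvar s | s in E] (nonmembers I).
Proof.
move=> I01 [cov disj]; split=> [l|l].
  have [m [k ->]] := mrconsP l.
  have -> : nonmembers I (mrcons m k) <-> nonmembers (janet_slice 0 I) m.
    rewrite /=; case: k => [|k]; first by rewrite ideal_slice0.
    by rewrite ideal_sliceS // I01.
  rewrite cov; split=> [[s sE sm]|[_ /imfsetP[s /= sE ->]]].
    by exists (stanley_addvar s); [apply: in_imfset | rewrite stanley_mon_addvar].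
  by rewrite stanley_mon_addvar; exists s.
have [m [k ->]] := mrconsP l.
move=> _ _ /imfsetP[s /= sE ->] /imfsetP[t /= tE ->].
by rewrite !stanley_mon_addvar => sm tm; congr stanley_addvar; apply: disj sm tm.
Qed.

(** Cases (C1) and (C3): the first family covers last exponent zero by means of $I_0$, the second
    covers positive ones by means of $I_1$. *)
Lemma mulvar_partition (E0 E1 : {fset stanley n}) :
  monomial_partition E0 (nonmembers (janet_slice 0 I)) ->
  monomial_partition E1 (nonmembers (janet_slice 1 I)) ->
  monomial_partition ([fset stanley_widen s | s in E0]
    `|` [fset stanley_mulvar s | s in E1])%fset (nonmembers I).
Proof.
move=> [cov0 disj0] [cov1 disj1]; split=> [l|l].
  have [m [k ->]] := mrconsP l; case: k => [|k].
    have -> : nonmembers I (mrcons m 0) <-> nonmembers (janet_slice 0 I) m.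
      by rewrite /= ideal_slice0.
    rewrite cov0; split=> [[s sE sm]|[t]].
      exists (stanley_widen s); last by rewrite stanley_mon_widen sm.
      by apply/fsetUP; left; apply: in_imfset.
    case/fsetUP => /imfsetP[s /= sE ->].
      by rewrite stanley_mon_widen andbT; exists s.
    by rewrite stanley_mon_mulvar andbF.
  have -> : nonmembers I (mrcons m k.+1) <-> nonmembers (janet_slice 1 I) m.
    by rewrite /= ideal_sliceS.
  rewrite cov1; split=> [[s sE sm]|[t]].
    exists (stanley_mulvar s); last by rewrite stanley_mon_mulvar sm.
    by apply/fsetUP; right; apply: in_imfset.
  case/fsetUP => /imfsetP[s /= sE ->].
    by rewrite stanley_mon_widen andbF.
  by rewrite stanley_mon_mulvar andbT; exists s.
have [m [k ->]] := mrconsP l.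
move=> _ _ /fsetUP[] /imfsetP[s /= sE ->] /fsetUP[] /imfsetP[t /= tE ->];
  rewrite ?stanley_mon_widen ?stanley_mon_mulvar => /andP[sm sk] /andP[tm tk].
- by congr stanley_widen; apply: disj0 sm tm.
(* Blocks of different families cannot meet: the last exponent would be both zero and positive. *)
- by rewrite (eqP sk) in tk.
- by rewrite (eqP tk) in sk.
- by congr stanley_mulvar; apply: disj1 sm tm.
Qed.

End LiftPartitions.

End LastVariable.

(** * The base case and the recursion *)

Lemma full_partition (n : nat) (M : set 'X_{1..n}) :
  (forall m, M m) -> monomial_partition [fset (0%MM, [set: 'I_n]%SET)] M.
Proof.
move=> MT; split=> [m|m s t]; last by rewrite !inE => /eqP-> /eqP->.
split=> // _; exists (0%MM, [set: 'I_n]%SET); first by rewrite inE.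
by apply/forallP => i; rewrite /= mnm0E inE.
Qed.

Lemma squarefree_stanley_full (n : nat) :
  squarefree_stanley (0%MM, [set: 'I_n]%SET).
Proof. by split=> [i|]; rewrite /= ?mnm0E ?finset.subsetT. Qed.

Lemma zero_no_monomial (K : fieldType) (n : nat) (m : 'X_{1..n}) :
  ~ [set 0 : {mpoly K[n]}] 'X_[m].
Proof.
by move=> /= /(congr1 (mcoeff m)) /eqP; rewrite mcoeffX eqxx mcoeff0 oner_eq0.
Qed.

Lemma janet0_partition (K : fieldType) (I : set {mpoly K[1]}) :
  squarefree_monomial_closed I ->
  monomial_partition (janet I) [set m | ~ I 'X_[m]] /\
  forall s, s \in janet I -> squarefree_stanley s.
Proof.
move=> Icl; have [up rad IP] := Icl; rewrite /janet.
case: asboolP => [->|nz].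
  split; first by apply: full_partition => m; apply: zero_no_monomial.
  by move=> s; rewrite inE => /eqP->; apply: squarefree_stanley_full.
(* Presents the generator $x_1$ as a set of monomials, so that [ideal_gen_monomialsP] applies. *)
have genX : [set ('X_ord0 : {mpoly K[1]})] =
    [set ('X_[m] : {mpoly K[1]}) | m in [set U_(ord0)%MM]].
  apply/seteqP; split=> p /=; first by move=> ->; exists U_(ord0)%MM.
  by case=> _ -> <-.
have leU (m : 'X_{1..1}) : (U_(ord0) <= m)%MM <-> m ord0 <> 0%N.
  split=> [/mnm_lepP/(_ ord0)|m0].
    by rewrite mnm1E /=; case: (m ord0).
  by apply/mnm_lepP => i; rewrite (ord1 i) mnm1E lt0n; apply/eqP.
case: asboolP => [IX|nX].
  have IE m : I 'X_[m] <-> m ord0 <> 0%N.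
    rewrite IX genX; split=> [/ideal_gen_monomialsP/(_ m)|/leU m0].
      by rewrite mcoeffX eqxx oner_eq0 => /(_ isT)[_ ->] /leU.
    by apply/ideal_gen_monomialsP => k /mcoeffX_neq0->; exists U_(ord0)%MM.
  split; last first.
    move=> s; rewrite inE => /eqP->; apply/squarefree_stanleyP => i /=.
    by rewrite mnm0E.
  split=> [m|m s t]; last by rewrite !inE => /eqP-> /eqP->.
  split=> /= [|[s]].
    move=> nI; have m0 : m ord0 = 0%N by apply: contrapT => /IE.
    exists (0%MM, finset.set0); first by rewrite inE.
    by apply/forallP => i; rewrite (ord1 i) /= mnm0E m0 eqxx orbT.
  rewrite inE => /eqP-> /forallP/(_ ord0) /=.
  by rewrite mnm0E inE /= => /eqP m0 /IE.
(* In one variable the only remaining ideal is the whole ring. If 1 were outside [I], then [I] would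
   be $(x_1)$. *)
have I1 : I 'X_[0%MM].
  apply: contrapT => nI0; apply: nX; rewrite genX; apply/seteqP.
  have Im0 m : I 'X_[m] -> (U_(ord0) <= m)%MM.
    move=> Im; apply/leU => m0; apply: nI0; suff <- : m = 0%MM by [].
    by apply/mnmP => i; rewrite (ord1 i) mnm0E.
  (* A nonzero element of [I] supplies a monomial of [I], and in one variable its capped version
     divides $x_1$. *)
  have IU : I 'X_[U_(ord0)%MM].
    have [p Ip p0] : exists2 p, I p & p != 0.
      apply: contrapT => no; apply: nz; apply/seteqP; split=> p /=.
        move=> Ip; apply/eqP/negPn/negP => p0; apply: no; by exists p.
      by move=> ->; apply/IP => m; rewrite mcoeff0 eqxx.
    have [m pm] : exists m, p@_m != 0.
      apply: contrapT => no; move/eqP: p0; apply; apply/mpolyP => m.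
      rewrite mcoeff0; apply/eqP/negPn/negP => pm; by apply: no; exists m.
    apply: up (rad m ((IP p).1 Ip m pm)); apply/mnm_lepP => i.
    by rewrite (ord1 i) mnm1E mradE geq_minr.
  split=> p.
    move/IP => pI; apply/ideal_gen_monomialsP => m /pI/Im0 Um.
    by exists U_(ord0)%MM.
  move/ideal_gen_monomialsP => pU; apply/IP => m /pU[_ ->] Um.
  exact: up Um IU.
(* With 1 in [I] no monomial is left over, matching the empty collection. *)
split=> //; split=> // m; split=> /= [|[//]].
by case; apply: up I1; apply/mnm_lepP => i; rewrite mnm0E.
Qed.

Lemma janet_partition (K : fieldType) (n : nat) (I : set {mpoly K[n.+1]}) :
  squarefree_monomial_closed I ->
  monomial_partition (janet I) [set m | ~ I 'X_[m]] /\
  forall s, s \in janet I -> squarefree_stanley s.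
Proof.
elim: n I => [|n IHn] I Icl; first exact: janet0_partition.
have [part0 sf0] := IHn _ (janet_slice_closed 0 Icl).
have [part1 sf1] := IHn _ (janet_slice_closed 1 Icl).
rewrite [janet I]/=; case: asboolP => [I01|_].
  split; first exact: addvar_partition.
  by move=> _ /imfsetP[s /= sE ->]; apply/squarefree_stanley_addvar/sf0.
case: asboolP => [I0|_].
  (* In (C3) the single space is the lift of the full partition belonging to $I_0 = 0$, so the
     collection takes the shape of (C1). *)
  have -> : [fset stanley_widen (0%MM, [set: 'I_n.+1]%SET)] =
      [fset stanley_widen s | s in [fset (0%MM : 'X_{1..n.+1}, [set: 'I_n.+1]%SET)]].
    by rewrite imfset_fset1.
  split.
    apply: mulvar_partition => //; apply: full_partition => m /=.
    by rewrite I0; apply: zero_no_monomial.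
  move=> _ /fsetUP[] /imfsetP[s /= sE ->].
    apply: squarefree_stanley_widen; move: sE; rewrite inE => /eqP->.
    exact: squarefree_stanley_full.
  exact/squarefree_stanley_mulvar/sf1.
split; first exact: mulvar_partition.
move=> _ /fsetUP[] /imfsetP[s /= sE ->].
  exact/squarefree_stanley_widen/sf0.
exact/squarefree_stanley_mulvar/sf1.
Qed.

(* The polynomial ring has n.+1 variables, i.e. at least one. *)
Theorem lemma2p3 (K : fieldType) (n : nat) (I : set {mpoly K[n.+1]})
    (hI : squarefree_monomial_ideal I) :
  squarefree_stanley_decomposition (ideal_compl I) (janet I).
Proof.
have /squarefree_monomial_idealP/janet_partition[part sf] := hI.
by split=> //; apply: partition_decomposition.
Qed.
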